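(* For every countable ordinal $\xi\in[1,\omega_1)$, the Schreier family of order $\xi$ coincides with the modified Schreier family of order $\xi$: $\mathcal{S}_\xi=\mathcal{S}^M_\xi$.
   Context: Notation: $[\mathbb{N}]^{<\omega}$ is the set of finite subsets of $\mathbb{N}=\{1,2,\dots\}$. For sets $A,B$ of positive integers, $A<B$ means $a<b$ for all $a\in A,b\in B$; for $m\in\mathbb N$, $m\leqslant A$ means $m\leqslant\min A$ and $m<A$ means $m<\min A$. Conventions: $\max\emptyset=0$, $\min\emptyset=\infty$. Schreier families $\mathcal{S}_\xi\subset[\mathbb{N}]^{<\omega}$, $\xi<\omega_1$: $\mathcal{S}_0=\{\{n\}:n\in\mathbb{N}\}\cup\{\emptyset\}$. If $\xi=\gamma+1$, then $\mathcal{S}_\xi$ consists of $\emptyset$ and all sets $\bigcup_{i=1}^nE_i$ with $n\in\mathbb N$, $E_1,\dots,E_n\in\mathcal{S}_\gamma$ nonempty and $n\leqslant E_1<E_2<\cdots<E_n$. If $\xi$ is a limit ordinal, a sequence of successor ordinals $(\alpha(\xi,n))_{n=1}^\infty\subset[1,\xi)$ increasing to $\xi$ is fixed, and $\mathcal{S}_\xi=\{E:\exists n\leqslant \min E\text{ with }E\in\mathcal{S}_{\alpha(\xi,n)}\}$. These sequences are chosen (which is possible) such that for every limit ordinal $\xi<\omega_1$: $\alpha(\xi,1)=1$, and for all $n\in\mathbb{N}$, if $A,B\in\mathcal{S}_{\alpha(\xi,n)}$ with $1<A<B$, then $A\cup B\in\mathcal{S}_{\alpha(\xi,n+1)}$.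 Modified Schreier families: $\mathcal{S}^M_0=\mathcal{S}_0$. If $\xi=\gamma+1$, then $\mathcal{S}^M_\xi$ is the family of all $\bigcup_{i=1}^nE_i$ with $n\in\mathbb N$, $E_1,\dots,E_n\in\mathcal{S}^M_\gamma$ pairwise disjoint and $E_i\geqslant n$ (i.e. $\min E_i\geqslant n$) for $i=1,\dots,n$. If $\xi$ is a limit ordinal, $\mathcal{S}^M_\xi=\{E:\exists n\leqslant\min E\text{ with }E\in\mathcal{S}^M_{\alpha(\xi,n)}\}$, with the same sequences $(\alpha(\xi,n))_n$ as for $\mathcal{S}_\xi$. *)

(* Defs.v *)
From HB Require Import structures.
From mathcomp Require Import all_boot all_order finmap.
From mathcomp Require Import boolp wochoice classical_sets functions cardinality.

Set Implicit Arguments.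
Unset Strict Implicit.
Unset Printing Implicit Defensive.

Import Order.TTheory.

Local Open Scope order_scope.
Local Open Scope classical_set_scope.

(* The type omega1 of countable ordinals is realized as the set of all points *)
(* with a countable initial segment in a well-ordering of the uncountable     *)
(* type set nat.  The lemmas omega1_min, omega1_countable_seg and             *)
(* omega1_uncountable characterize its order type.                            *)

Definition wo_rel : rel (set nat) := sval (well_ordering_principle (set nat)).

Record omega1 := Omega1 {
  omega1_val :> set nat;
  omega1P : countable [set y | wo_rel y omega1_val] }.

HB.instance Definition _ := [isSub of omega1 for omega1_val].
HB.instance Definition _ := [Equality of omega1 by <:].
HB.instance Definition _ := [Choice of omega1 by <:].

Lemma wo_relP : well_order wo_rel.
Proof. by rewrite /wo_rel; case: well_ordering_principle. Qed.

Lemma wo_rel_min (A : set (set nat)) : A !=set0 ->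
  exists2 x, A x & forall y, A y -> wo_rel x y.
Proof.
move=> [a Aa].
have [|z [[zA zmin] _]] := wo_relP (A := mem A).
  by exists a; apply/mem_set.
by exists z => [|y Ay]; [exact/set_mem | exact/zmin/mem_set].
Qed.

Lemma wo_rel_total : total_order wo_rel.
Proof.
have tot : total wo_rel.
  move=> x y; have [|z /= [] -> h] := @wo_rel_min [set x; y].
  - by exists x; left.
  - by rewrite h //; right.
  - by rewrite [wo_rel y x]h ?orbT //; left.
have anti : antisymmetric wo_rel.
  move=> x y /andP[xy yx].
  have rxx u : wo_rel u u by have := tot u u; rewrite orbb.
  have [|z [_ zu]] := wo_relP (A := mem [set x; y]).
    by exists x; apply/mem_set; left.
  have -> : x = z.
    by apply/esym/zu; split=> [|u /set_mem[]->//]; apply/mem_set; left.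
  by apply: zu; split=> [|u /set_mem[]->//]; apply/mem_set; right.
split=> //; split=> //; split=> [x|]; first by have := tot x x; rewrite orbb.
move=> y x z xy yz.
have [|m /= [[]|] -> h] := @wo_rel_min [set x; y; z].
- by exists x; left; left.
- by apply: h; right.
- have yx : wo_rel y x by apply: h; left; left.
  by have -> : x = y by apply/anti/andP.
- have zy : wo_rel z y by apply: h; left; right.
  by have <- : y = z by apply/anti/andP.
Qed.

Definition omega1_le (x y : omega1) := wo_rel x y.

Fact omega1_le_refl : reflexive omega1_le.
Proof. by move=> x; case: wo_rel_total => -[[r _] _] _; exact: r. Qed.

Fact omega1_le_anti : antisymmetric omega1_le.
Proof.
by move=> x y h; apply/val_inj; case: wo_rel_total => -[_ a] _; exact: a.
Qed.

Fact omega1_le_trans : transitive omega1_le.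
Proof. by move=> y x z; case: wo_rel_total => -[[_ t] _] _; exact: t. Qed.

Fact omega1_le_total : total omega1_le.
Proof. by move=> x y; case: wo_rel_total => _; apply. Qed.

Fact omega1_display : Order.disp_t. Proof. exact: Order.Disp tt tt. Qed.

HB.instance Definition _ := Order.Le_isPOrder.Build omega1_display omega1
  omega1_le_refl omega1_le_anti omega1_le_trans.
HB.instance Definition _ := Order.POrder_isTotal.Build omega1_display omega1
  omega1_le_total.

Lemma omega1_min (A : set omega1) : A !=set0 ->
  exists2 x, A x & forall y, A y -> x <= y.
Proof.
move=> [a Aa]; have [|_ [x Ax <-] h] := @wo_rel_min (omega1_val @` A).
  by exists (omega1_val a), a.
by exists x => // y Ay; apply: h; exists y.
Qed.

Lemma omega1_countable_seg (x : omega1) : countable [set y | y <= x].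
Proof.
have /countable_injP[f finj] := omega1P x.
apply/countable_injP; exists (f \o omega1_val) => y z yx zx e.
by apply/val_inj/finj => //; apply/mem_set.
Qed.

Lemma uncountable_set_nat : ~ countable [set: set nat].
Proof.
move=> /countable_injP[f finj].
have {}finj A B : f A = f B -> A = B by apply: finj; apply/mem_set.
pose D : set nat := [set n | exists2 A, f A = n & ~ A n].
have [DD|nDD] := pselect (D (f D)).
  by case: (DD) => A /finj ->.
by apply: (nDD); exists D.
Qed.

Lemma omega1_uncountable : ~ countable [set: omega1].
Proof.
move=> cT; pose A := omega1_val @` [set: omega1].
have cA : countable A by exact: (sub_countable (card_image_le _ _)).
have [|x nAx xmin] := @wo_rel_min (~` A).
  apply: contrapT => /set0P/negP/negPn/eqP A0; apply: uncountable_set_nat.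
  by rewrite -[setT]setC0 -A0 setCK.
have cx : countable [set y | wo_rel y x].
  apply: (@sub_countable _ _ _ (A `|` [set x])).
    apply: subset_card_le => y /= yx.
    have [|nAy] := pselect (A y); [by left | right => /=].
    case: wo_rel_total => -[_ anti] _; apply: anti.
    by rewrite yx xmin.
  rewrite -bigcup2E; apply: bigcup_countable => // i _.
  by case: i => [|[|i]] //=; exact: countable1.
by apply: nAx; exists (Omega1 cx).
Qed.

Lemma omega1_inhabited : [set: omega1] !=set0.
Proof.
apply: contrapT => /set0P/negP/negPn/eqP A0; apply: omega1_uncountable.
by rewrite A0.
Qed.

Definition omega1_zero : omega1 := s2val (cid2 (omega1_min omega1_inhabited)).

Fact omega1_zero_le (x : omega1) : omega1_zero <= x.
Proof. by rewrite /omega1_zero; case: cid2 => z _ /= ->. Qed.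

HB.instance Definition _ :=
  Order.hasBottom.Build omega1_display omega1 omega1_zero_le.

Lemma omega1_nomax (x : omega1) : [set y | x < y] !=set0.
Proof.
apply: contrapT => /set0P/negP/negPn/eqP A0; apply: omega1_uncountable.
have -> : [set: omega1] = [set y | y <= x]; last exact: omega1_countable_seg.
apply/seteqP; split=> y //= _; rewrite leNgt; apply/negP => xy.
by have : [set y | x < y] y by []; rewrite A0.
Qed.

Definition osucc (x : omega1) : omega1 :=
  s2val (cid2 (omega1_min (omega1_nomax x))).

Lemma osucc_gt (x : omega1) : x < osucc x.
Proof. by rewrite /osucc; case: cid2. Qed.

Lemma osucc_le (x y : omega1) : x < y -> osucc x <= y.
Proof. by rewrite /osucc; case: cid2 => z /= _ h; exact: h. Qed.

Definition is_succ (x : omega1) : Prop := exists y, x = osucc y.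

Definition is_limit (x : omega1) : Prop := x != \bot /\ ~ is_succ x.

(* Finite subsets of {1, 2, ...} are values of {fset nat} not containing 0.   *)
(* These three relations are vacuously true on the empty set, according to    *)
(* the conventions max set0 = 0 and min set0 = oo.                            *)

Definition le_fset (m : nat) (A : {fset nat}) : Prop :=
  forall a, a \in A -> (m <= a)%N.

Definition lt_fset (m : nat) (A : {fset nat}) : Prop :=
  forall a, a \in A -> (m < a)%N.

Definition fset_lt (A B : {fset nat}) : Prop :=
  forall a b, a \in A -> b \in B -> (a < b)%N.

(* Both families are defined for an arbitrary assignment alpha of sequences   *)
(* to the limit ordinals; alpha xi n is used only for xi a limit and n > 0.   *)
(* The positive number n of sets in a union is written n.+1.                  *)

Inductive schreier (alpha : omega1 -> nat -> omega1) :
    omega1 -> {fset nat} -> Prop :=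
| schreier_zero1 (k : nat) : (0 < k)%N -> schreier alpha \bot [fset k]%fset
| schreier_zero0 : schreier alpha \bot fset0
| schreier_succ0 (gamma : omega1) : schreier alpha (osucc gamma) fset0
| schreier_succ (gamma : omega1) (n : nat) (E : 'I_n.+1 -> {fset nat}) :
    (forall i, schreier alpha gamma (E i)) ->
    (forall i, E i != fset0) ->
    le_fset n.+1 (E ord0) ->
    (forall i j : 'I_n.+1, (i < j)%N -> fset_lt (E i) (E j)) ->
    schreier alpha (osucc gamma) (\big[fsetU/fset0]_(i < n.+1) E i)
| schreier_limit (xi : omega1) (n : nat) (E : {fset nat}) :
    is_limit xi -> (0 < n)%N -> le_fset n E ->
    schreier alpha (alpha xi n) E -> schreier alpha xi E.

Inductive mod_schreier (alpha : omega1 -> nat -> omega1) :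
    omega1 -> {fset nat} -> Prop :=
| mod_schreier_zero (E : {fset nat}) :
    schreier alpha \bot E -> mod_schreier alpha \bot E
| mod_schreier_succ (gamma : omega1) (n : nat) (E : 'I_n.+1 -> {fset nat}) :
    (forall i, mod_schreier alpha gamma (E i)) ->
    (forall i j : 'I_n.+1, i != j -> [disjoint E i & E j]%fset) ->
    (forall i, le_fset n.+1 (E i)) ->
    mod_schreier alpha (osucc gamma) (\big[fsetU/fset0]_(i < n.+1) E i)
| mod_schreier_limit (xi : omega1) (n : nat) (E : {fset nat}) :
    is_limit xi -> (0 < n)%N -> le_fset n E ->
    mod_schreier alpha (alpha xi n) E -> mod_schreier alpha xi E.

(* The standing choice of the sequences (alpha(xi, n)), for n = 1, 2, ...     *)
Record schreier_sequences (alpha : omega1 -> nat -> omega1) : Prop := {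
  alpha_succ : forall xi n, is_limit xi -> (0 < n)%N -> is_succ (alpha xi n);
  alpha_lt : forall xi n, is_limit xi -> (0 < n)%N -> alpha xi n < xi;
  alpha_incr : forall xi n, is_limit xi -> (0 < n)%N ->
    alpha xi n < alpha xi n.+1;
  alpha_sup : forall xi beta, is_limit xi -> beta < xi ->
    exists2 n, (0 < n)%N & beta < alpha xi n;
  alpha_one : forall xi, is_limit xi -> alpha xi 1%N = osucc \bot;
  alpha_union : forall xi n (A B : {fset nat}), is_limit xi -> (0 < n)%N ->
    schreier alpha (alpha xi n) A -> schreier alpha (alpha xi n) B ->
    lt_fset 1 A -> fset_lt A B ->
    schreier alpha (alpha xi n.+1) (A `|` B)%fset
}.

(* Main.v *)
Require Import Defs.
From mathcomp Require Import all_boot all_order finmap.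
From mathcomp Require Import boolp wochoice classical_sets functions cardinality.

(* By transfinite induction, a finite set covered by [n] sets of [S_xi] is    *)
(* covered by [n] successive sets of [S_xi]; given heredity, this is the      *)
(* inclusion of the modified family into the Schreier family at successor     *)
(* steps, all other inclusions being formal.                                  *)
(*                                                                            *)
(* It is enough to treat [n = 2]: an exchange between the first set and       *)
(* another one lengthens the initial segment of the union contained in the    *)
(* first set, because the last element of a set of [S_xi] may be moved to the *)
(* left as long as it stays above the other ones.                             *)
(*                                                                            *)
(* For [n = 2], let [a = min A <= b = min B].  At a successor, [A] and [B]    *)
(* are made of at most [a], resp. [b], sets of the previous family, and       *)
(* [A `|` B] of as many successive ones, of which the first [a] are grouped.  *)
(* At a limit, [A = {1}] if [a = 1], and the case [A < B] is trivial.         *)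
(* Otherwise [A] and [B] both belong to the family of index [alpha xi b],     *)
(* so by induction and the choice of [alpha] their union belongs to that of   *)
(* index [alpha xi b.+1]; hence cutting [A `|` B] just after [b] works.       *)

Set Implicit Arguments.
Unset Strict Implicit.
Unset Printing Implicit Defensive.

Import Order.TTheory.

Local Open Scope order_scope.
Local Open Scope fset_scope.

(** The statement carried through the transfinite induction is the list of clauses in [regular]:
    heredity, a limited shift to the left, and the rearrangement of two sets into successive ones.
    For any regular family, [cover_seq_cover] extends the rearrangement from two sets to [n] sets.
    The Schreier families arise from singletons by two operations, [next] at successors and [diag]
    at limits. Both preserve regularity ([next_regular], [diag_regular]), the conditions on [alpha]
    entering at limits; this gives [schreier_regular]. The comparison in [schreier_mod_schreier]
    then uses that successive sets are disjoint in one direction, and the rearrangement in the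
    other. *)

Section Coverings.
Variable S : {fset nat} -> Prop.

(** Pieces may overlap and may be empty, so that for a family containing the empty set [n] is only
    an upper bound on their number. *)
Fixpoint cover (n : nat) (A : {fset nat}) : Prop :=
  if n is m.+1 then exists F G, [/\ S F, cover m G & A = F `|` G]
  else A = fset0.

Fixpoint seq_cover (n : nat) (A : {fset nat}) : Prop :=
  if n is m.+1 then
    exists F G, [/\ S F, seq_cover m G, fset_lt F G & A = F `|` G]
  else A = fset0.

(** The passage from S_gamma to S_(gamma+1), with the bound put on the whole union and empty pieces
    tolerated; [n = 0] yields the empty set. *)
Definition next (A : {fset nat}) : Prop :=
  exists2 n, le_fset n A & seq_cover n A.

End Coverings.

Definition below (A : {fset nat}) (y : nat) := [fset a in A | (a < y)%N].
Definition above (A : {fset nat}) (y : nat) := [fset a in A | (y <= a)%N].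

Lemma in_below A y a : (a \in below A y) = (a \in A) && (a < y)%N.
Proof. by rewrite !inE. Qed.

Lemma in_above A y a : (a \in above A y) = (a \in A) && (y <= a)%N.
Proof. by rewrite !inE. Qed.

(** The invariant of the induction. With heredity, [regular1] keeps 0 out of every member.
    [regular_left] replaces the nonempty part of [A] from [y] on by the single point [y]; it
    survives both constructions because it either preserves the minimum or leaves a singleton. *)
Record regular (S : {fset nat} -> Prop) : Prop := {
  regular0 : S fset0;
  regular1 : forall y, S [fset y] <-> (0 < y)%N;
  regular_sub : forall A B, S A -> B `<=` A -> S B;
  regular_left : forall A x y, S A -> x \in A -> (y <= x)%N -> (0 < y)%N ->
    S (y |` below A y);
  regular_two : forall A B, S A -> S B ->
    exists F G, [/\ S F, S G, fset_lt F G & A `|` B = F `|` G]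
}.

Lemma fset_minP (A : {fset nat}) :
  A != fset0 -> exists2 a, a \in A & le_fset a A.
Proof.
case/fset0Pn=> x xA; have exA : exists a, a \in A by exists x.
by case: (ex_minnP exA) => a aA amin; exists a.
Qed.

Lemma fset_bounded (A : {fset nat}) : exists t, forall a, a \in A -> (a < t)%N.
Proof.
exists (\max_(a <- A) a).+1 => a aA.
by rewrite ltnS; exact: leq_bigmax_seq.
Qed.

Lemma le_fset_sub n (A B : {fset nat}) : le_fset n A -> B `<=` A -> le_fset n B.
Proof. by move=> nA /fsubsetP BA a /BA /nA. Qed.

Lemma fset_lt_sub (A B C D : {fset nat}) :
  fset_lt A B -> C `<=` A -> D `<=` B -> fset_lt C D.
Proof. by move=> AB /fsubsetP CA /fsubsetP DB a b /CA aA /DB; exact: AB. Qed.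

(** * Rearranging coverings by a regular family *)

Section RegularCoverings.
Variables (S : {fset nat} -> Prop) (Sreg : regular S).

Lemma cover0 n : cover S n fset0.
Proof.
elim: n => //= n IHn; exists fset0, fset0; rewrite fsetU0.
by split=> //; exact: regular0.
Qed.

Lemma seq_cover0 n : seq_cover S n fset0.
Proof.
elim: n => //= n IHn; exists fset0, fset0; rewrite fsetU0.
by split=> //; exact: regular0.
Qed.

Lemma cover_sub n A B : cover S n A -> B `<=` A -> cover S n B.
Proof.
elim: n A B => /= [A B -> |n IHn A B [F [G [SF cG ->]]] BA].
  by rewrite fsubset0 => /eqP.
exists (B `&` F), (B `&` G); split.
- exact: (regular_sub Sreg SF (fsubsetIr _ _)).
- exact: (IHn _ _ cG (fsubsetIr _ _)).
- by rewrite -fsetIUr; apply/esym/fsetIidPl.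
Qed.

Lemma seq_cover_sub n A B : seq_cover S n A -> B `<=` A -> seq_cover S n B.
Proof.
elim: n A B => /= [A B -> |n IHn A B [F [G [SF cG FG ->]]] BA].
  by rewrite fsubset0 => /eqP.
exists (B `&` F), (B `&` G); split.
- exact: (regular_sub Sreg SF (fsubsetIr _ _)).
- exact: (IHn _ _ cG (fsubsetIr _ _)).
- exact: fset_lt_sub FG (fsubsetIr _ _) (fsubsetIr _ _).
- by rewrite -fsetIUr; apply/esym/fsetIidPl.
Qed.

Lemma seq_cover_cover n A : seq_cover S n A -> cover S n A.
Proof.
elim: n A => //= n IHn A [F [G [SF /IHn cG _ ->]]].
by exists F, G.
Qed.

Lemma coverU m n A B : cover S m A -> cover S n B -> cover S (m + n) (A `|` B).
Proof.
move=> + cB; elim: m A => /= [A ->|m IHm A [F [G [SF cG ->]]]].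
  by rewrite fset0U.
by exists F, (G `|` B); rewrite fsetUA; split=> //; exact: IHm.
Qed.

Lemma cover_leq m n A : (m <= n)%N -> cover S m A -> cover S n A.
Proof.
move=> /subnKC <- cA; rewrite -[A]fsetU0.
by apply: coverU => //; exact: cover0.
Qed.

Lemma cover_pick n A x : cover S n A -> x \in A ->
  exists m D C, [/\ n = m.+1, S D, x \in D, cover S m C & A = D `|` C].
Proof.
elim: n A => /= [A ->|n IHn A [F [G [SF cG ->]]]]; first by rewrite inE.
have [xF _|xF] := boolP (x \in F); first by exists n, F, G.
rewrite inE (negPf xF) /= => /(IHn _ cG)[m [D [C [-> SD xD cC ->]]]].
exists m.+1, D, (F `|` C); split=> //=; first by exists F, C.
by rewrite fsetUCA.
Qed.

Lemma seq_cover_split m n A : seq_cover S (m + n) A ->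
  exists F G, [/\ seq_cover S m F, seq_cover S n G, fset_lt F G & A = F `|` G].
Proof.
elim: m A => /= [A cA|m IHm A [F [G [SF cG FG ->]]]].
  by exists fset0, A; rewrite fset0U; split=> //.
have [H [K [cH cK HK GE]]] := IHm _ cG.
exists (F `|` H), K; split=> //; last by rewrite GE fsetUA.
  exists F, H; split=> //; apply: fset_lt_sub FG _ _ => //.
  by rewrite GE fsubsetUl.
move=> a b; rewrite inE => /orP[aF bK|]; last exact: HK.
by apply: FG => //; rewrite GE inE bK orbT.
Qed.

(* If [t] is missing from [E], exchange [E] with a covering set containing [t]. *)
Lemma cover_initial n A t : cover S n.+1 A ->
  exists E C, [/\ S E, cover S n C, A = E `|` C &
    fset_lt E C \/ below A t `<=` E].
Proof.
move=> cA; elim: t => [|t [E [C [SE cC AE]]]].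
  case: cA => E [C [SE cC AE]]; exists E, C; split=> //; right.
  by apply/fsubsetP => a; rewrite in_below ltn0 andbF.
case=> [EC|AtE]; first by exists E, C; split=> //; left.
have [tE|tNE] := boolP (t \in E).
  exists E, C; split=> //; right; apply/fsubsetP => a.
  rewrite in_below ltnS leq_eqVlt => /andP[aA /orP[/eqP->//|at_]].
  by apply: (fsubsetP AtE); rewrite in_below aA.
have [tA|tNA] := boolP (t \in A); last first.
  exists E, C; split=> //; right; apply/fsubsetP => a.
  rewrite in_below ltnS leq_eqVlt => /andP[aA /orP[/eqP at_|at_]].
    by rewrite -at_ aA in tNA.
  by apply: (fsubsetP AtE); rewrite in_below aA.
(* If [E] goes beyond [t], its tail can be replaced by [t], and [E] and the piece [D] containing [t]
   can be rearranged as [F] before [G]; the number of pieces does not change. *)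
have [[x /andP[xE tx]]|Et] := pselect (exists x, (x \in E) && (t <= x)%N).
  have : t \in C by move: tA; rewrite AE inE (negPf tNE).
  case/(cover_pick cC) => m [D [C' [nE SD tD cC' CE]]].
  have t_gt0 : (0 < t)%N.
    by apply/(regular1 Sreg)/(regular_sub Sreg SD); rewrite fsub1set.
  have SI := regular_left Sreg SE xE tx t_gt0.
  have [F [G [SF SG FG EDE]]] := regular_two Sreg SE SD.
  have belowE a : a \in A -> (a < t.+1)%N -> a \in t |` below E t.
    rewrite ltnS leq_eqVlt in_fset1U in_below => aA /orP[-> //|at_].
    by rewrite at_ (fsubsetP AtE) ?orbT // in_below aA.
  have AED : A = (F `|` G) `|` C' by rewrite -EDE AE CE fsetUA.
  have IED : t |` below E t `<=` F `|` G.
    rewrite -EDE; apply/fsubsetP => a; rewrite in_fset1U in_below inE.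
    by case/orP => [/eqP->|/andP[->]//]; rewrite tD orbT.
  (* If [F] goes beyond [t], then [G] lies beyond [t] too, so [F] holds all of [A] up to [t].
     Otherwise [F] is contained in [E] cut below [t] with [t] added, and that set takes its
     place. *)
  have [[y /andP[yF ty]]|Ft] := pselect (exists y, (y \in F) && (t < y)%N).
    exists F, (G `|` C'); split=> //.
    - by rewrite nE /=; exists G, C'.
    - by rewrite AED fsetUA.
    right; apply/fsubsetP => a; rewrite in_below => /andP[aA at_].
    have := fsubsetP IED _ (belowE _ aA at_); rewrite inE => /orP[//|aG].
    have := FG _ _ yF aG; rewrite ltnNge; case/negP.
    by apply: leq_trans ty; rewrite -ltnS ltnW.
  exists (t |` below E t), (G `|` C'); split=> //.
  - by rewrite nE /=; exists G, C'.
  - rewrite AED -fsetUA; apply/eqP; rewrite eqEfsubset.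
    apply/andP; split; rewrite fsubUset fsubsetUr andbT; last first.
      by rewrite fsetUA (fsubset_trans IED) // fsubsetUl.
    apply/fsubsetP => a aF; rewrite inE belowE //.
      by rewrite AED !inE aF.
    by rewrite ltnS leqNgt; apply/negP => ta; apply: Ft; exists a; rewrite aF.
  - by right; apply/fsubsetP => a; rewrite in_below => /andP[aA] /belowE; apply.
(* Here [E] stays below [t] and contains everything of [A] below [t]: it is an initial segment of
   [A], and the rest follows it. *)
exists E, (A `\` E); split=> //.
- apply: cover_sub cC _; apply/fsubsetP => a.
  by rewrite inE AE inE; case: (a \in E).
- by apply/fsetP => a; rewrite AE !inE; case: (a \in E).
- left=> a b aE; rewrite inE => /andP[bE bA]; apply: (@leq_trans t).
    by rewrite ltnNge; apply/negP => ta; apply: Et; exists a; rewrite aE.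
  rewrite leqNgt; apply/negP => bt; case/negP: bE.
  by apply: (fsubsetP AtE); rewrite in_below bA.
Qed.

(** With [t] above all of [A], [cover_initial] either splits off a first piece, leaving [n] sets to
    rearrange, or gives one piece equal to [A]. *)
Lemma cover_seq_cover n A : cover S n A -> seq_cover S n A.
Proof.
elim: n A => // n IHn A; have [t At] := fset_bounded A.
case/(cover_initial t) => E [C [SE cC AE [EC|AtE]]]; exists E.
  by exists C; split=> //; exact: IHn.
exists fset0; rewrite fsetU0; split=> //.
- exact: seq_cover0.
apply/eqP; rewrite eqEfsubset {2}AE fsubsetUl andbT.
by apply/fsubsetP => a aA; apply: (fsubsetP AtE); rewrite in_below aA At.
Qed.

(** The shift takes place in the first piece reaching [y]; the pieces after it lie above [y] and
    disappear. *)
Lemma seq_cover_left n A x y : seq_cover S n A -> x \in A -> (y <= x)%N ->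
  (0 < y)%N -> seq_cover S n (y |` below A y).
Proof.
elim: n A => /= [A ->|n IHn A [F [G [SF cG FG ->]]]]; first by rewrite inE.
move=> xFG yx y0.
have [[z /andP[zF yz]]|Fy] := pselect (exists z, (z \in F) && (y <= z)%N).
  exists (y |` below F y), fset0; split.
  - exact: regular_left zF yz y0.
  - exact: seq_cover0.
  - by [].
  - apply/fsetP => a; rewrite fsetU0 !in_fset1U !in_below inE.
    case: (boolP (a \in G)) => aG; last by rewrite orbF.
    by rewrite [(a < y)%N]ltnNge (leq_trans yz (ltnW (FG _ _ zF aG))) !andbF.
have {}Fy a : a \in F -> (a < y)%N.
  by move=> aF; rewrite ltnNge; apply/negP => ya; apply: Fy; exists a; rewrite aF.
have xG : x \in G.
  by move: xFG; rewrite inE => /orP[/Fy|//]; rewrite ltnNge yx.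
exists F, (y |` below G y); split=> //; first exact: IHn.
  move=> a b aF; rewrite in_fset1U in_below => /orP[/eqP->|/andP[+ _]].
    exact: Fy.
  exact: FG.
apply/fsetP => a; rewrite !(in_fset1U, in_below, inE).
case: (boolP (a \in F)) => aF; last by [].
by rewrite Fy ?orbT.
Qed.

(** * The successor step preserves regularity *)

Lemma next0 : next S fset0.
Proof. by exists 0%N. Qed.

Lemma next1 y : next S [fset y] <-> (0 < y)%N.
Proof.
split=> [[[|n] ny cy]|y0].
- by move/fsetP/(_ y): cy; rewrite !inE eqxx.
- by apply: leq_trans (ny y _); rewrite ?inE.
exists 1%N; first by move=> a; rewrite inE => /eqP->.
exists [fset y], fset0; rewrite fsetU0; split=> //.
- exact/(regular1 Sreg).
Qed.

Lemma next_sub A B : next S A -> B `<=` A -> next S B.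
Proof.
by case=> n nA cA BA; exists n; [exact: le_fset_sub BA | exact: seq_cover_sub BA].
Qed.

Lemma next_left A x y : next S A -> x \in A -> (y <= x)%N -> (0 < y)%N ->
  next S (y |` below A y).
Proof.
case=> n nA cA xA yx y0.
have [->|[a]] := fset_0Vmem (below A y).
  by rewrite fsetU0; exact/next1.
rewrite in_below => /andP[aA ay]; exists n; last exact: seq_cover_left xA _ _.
move=> c; rewrite in_fset1U in_below => /orP[/eqP->|/andP[/nA]//].
exact: leq_trans (nA _ aA) (ltnW ay).
Qed.

Lemma next_two_le A B a b :
  a \in A -> le_fset a A -> le_fset b B -> (a <= b)%N -> b \in B ->
  next S A -> next S B ->
  exists F G, [/\ next S F, next S G, fset_lt F G & A `|` B = F `|` G].
Proof.
move=> aA leaA lebB ab bB nA nB; case: (nA) (nB) => p pA cA [q qB cB].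
have leaAB : le_fset a (A `|` B).
  by move=> c; rewrite inE => /orP[/leaA//|/lebB]; exact: leq_trans.
(* The pieces of [A] number at most [a], its minimum. After rearrangement the first [a] pieces form
   [F] and the other [q] form [G], where [q] is at most [b]. *)
have cAB : seq_cover S (a + q) (A `|` B).
  apply: cover_seq_cover; apply: coverU; last exact: seq_cover_cover.
  exact: cover_leq (pA _ aA) (seq_cover_cover cA).
have [F [G [cF cG FG ABE]]] := seq_cover_split cAB.
(* [G] may start before [b], hence possibly before [q]. In that case [F] lies below [b], so the part
   of the union from [b] on is within [G] and needs only [q] pieces, while the part below [b] comes
   from [A] alone. *)
have [[g /andP[gG gb]]|Gb] := pselect (exists g, (g \in G) && (g < b)%N).
  exists (below A b), (above (A `|` B) b); split.
  - by apply: next_sub nA _; apply/fsubsetP => c; rewrite in_below => /andP[].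
  - exists q.
      move=> c; rewrite in_above => /andP[_]; exact: leq_trans (qB _ bB).
    apply: seq_cover_sub cG _; apply/fsubsetP => c.
    rewrite in_above ABE inE => /andP[/orP[cF'|//] bc].
    have := leq_trans (FG _ _ cF' gG) (ltnW gb).
    by rewrite ltnNge bc.
  - move=> c d; rewrite in_below in_above => /andP[_ cb] /andP[_].
    exact: leq_trans.
  apply/fsetP => c; rewrite !(in_above, in_below, inE).
  case: (leqP b c) => bc; rewrite ?andbF ?andbT ?orbF //.
  by rewrite orbC; case: (boolP (c \in B)) => // /lebB; rewrite leqNgt bc.
exists F, G; split=> //.
  by exists a => //; apply: le_fset_sub leaAB _; rewrite ABE fsubsetUl.
exists q => // g gG; apply: leq_trans (qB _ bB) _.
by rewrite leqNgt; apply/negP => gb; apply: Gb; exists g; rewrite gG.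
Qed.

End RegularCoverings.

Lemma two_sym (S : {fset nat} -> Prop) :
  S fset0 ->
  (forall A B a b, a \in A -> le_fset a A -> le_fset b B -> (a <= b)%N ->
    b \in B -> S A -> S B ->
    exists F G, [/\ S F, S G, fset_lt F G & A `|` B = F `|` G]) ->
  forall A B, S A -> S B ->
    exists F G, [/\ S F, S G, fset_lt F G & A `|` B = F `|` G].
Proof.
move=> S0 two A B SA SB.
have [->|A0] := eqVneq A fset0.
  by exists fset0, B; split=> //.
have [->|B0] := eqVneq B fset0.
  by exists A, fset0; split=> //.
have [[a aA aleA] [b bB bleB]] := (fset_minP A0, fset_minP B0).
have [ab|/ltnW ba] := leqP a b; first exact: two ab bB SA SB.
by rewrite fsetUC; apply: two ba aA SB SA.
Qed.

Lemma next_regular S : regular S -> regular (next S).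
Proof.
move=> Sreg; split.
- exact: next0.
- exact: next1.
- exact: next_sub.
- exact: next_left.
- by apply: two_sym => [|A B a b]; [exact: next0 | exact: next_two_le].
Qed.

(** * The limit step preserves regularity *)

Section LimitFamily.
(** [T n] stands for the family of index alpha(xi, n); [T1] reflects alpha(xi, 1) = 1, and [TU] is
    the union condition on the sequences. *)
Variable T : nat -> {fset nat} -> Prop.
Hypothesis Treg : forall n, (0 < n)%N -> regular (T n).
Hypothesis T1 : forall A, T 1 A -> 1%N \in A -> A = [fset 1%N].
Hypothesis TU : forall n A B, (0 < n)%N -> T n A -> T n B ->
  lt_fset 1 A -> fset_lt A B -> T n.+1 (A `|` B).

Definition diag (A : {fset nat}) : Prop :=
  exists n, [/\ (0 < n)%N, le_fset n A & T n A].

Lemma diag0 : diag fset0.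
Proof. by exists 1%N; split=> //; exact: regular0 (Treg _). Qed.

Lemma diag1 y : diag [fset y] <-> (0 < y)%N.
Proof.
split=> [[n [n0 ny _]]|y0]; first by apply: leq_trans (ny y _); rewrite ?inE.
exists 1%N; split=> //; first by move=> a; rewrite inE => /eqP->.
exact/(regular1 (Treg _)).
Qed.

Lemma diag_sub A B : diag A -> B `<=` A -> diag B.
Proof.
case=> n [n0 nA TA] BA; exists n; split=> //; first exact: le_fset_sub BA.
exact: (regular_sub (Treg n0) TA).
Qed.

Lemma diag_left A x y : diag A -> x \in A -> (y <= x)%N -> (0 < y)%N ->
  diag (y |` below A y).
Proof.
case=> n [n0 nA TA] xA yx y0.
have [->|[a]] := fset_0Vmem (below A y).
  by rewrite fsetU0; exact/diag1.
rewrite in_below => /andP[aA ay].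
exists n; split=> //; last exact: (regular_left (Treg n0) TA xA yx y0).
move=> c; rewrite in_fset1U in_below => /orP[/eqP->|/andP[/nA]//].
exact: leq_trans (nA _ aA) (ltnW ay).
Qed.

(** Taking the second set empty in [TU] raises the index by one; this is why 1 has to stay out of
    [A]. *)
Lemma diag_monotone m n A : (0 < m)%N -> (m <= n)%N -> lt_fset 1 A ->
  T m A -> T n A.
Proof.
move=> m0 /subnKC <- A1 TA; elim: (n - m)%N => [|k IHk]; first by rewrite addn0.
have mk0 : (0 < m + k)%N by rewrite addn_gt0 m0.
rewrite addnS -[A]fsetU0; apply: TU => //.
exact: regular0 (Treg _).
Qed.

Lemma diag_two_le A B a b :
  a \in A -> le_fset a A -> le_fset b B -> (a <= b)%N -> b \in B ->
  diag A -> diag B ->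
  exists F G, [/\ diag F, diag G, fset_lt F G & A `|` B = F `|` G].
Proof.
move=> aA leaA lebB ab bB dA dB; case: (dA) (dB) => k [k0 kA TA] [l [l0 lB TB]].
have [[x /andP[xA bx]]|Ab] := pselect (exists x, (x \in A) && (b <= x)%N); last first.
  exists A, B; split=> // c d cA dB'; apply: leq_trans (lebB _ dB').
  by rewrite ltnNge; apply/negP => bc; apply: Ab; exists c; rewrite cA.
have a0 : (0 < a)%N := leq_trans k0 (kA _ aA).
have [a1|a1] := leqP a 1.
  have {a0 a1}a1 : a = 1%N by apply/eqP; rewrite eqn_leq a1.
  have k1 : k = 1%N by apply/eqP; rewrite eqn_leq k0 -{1}a1 kA.
  have AE : A = [fset 1%N] by apply: T1; [rewrite -k1 | rewrite -{1}a1].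
  exists A, (B `\ 1%N); split=> //.
  - by apply: diag_sub dB _; exact: fsubsetDl.
  - move=> c d; rewrite AE !inE => /eqP-> /andP[d1 dB'].
    by rewrite ltn_neqAle eq_sym d1 -a1 (leq_trans ab (lebB _ dB')).
  - by apply/fsetP => c; rewrite AE !inE; case: (c == 1%N).
have b0 : (0 < b)%N by apply: leq_trans ab.
have A1 : lt_fset 1 A by move=> c /leaA; exact: leq_trans.
have B1 : lt_fset 1 B by move=> c /lebB; exact: leq_trans (leq_trans a1 ab).
have TbA : T b A by apply: diag_monotone TA => //; exact: leq_trans (kA _ aA) ab.
have TbB : T b B by apply: diag_monotone TB => //; exact: lB.
have TAB : T b.+1 (A `|` B).
  have [F [G [TF TG FG ABE]]] := regular_two (Treg b0) TbA TbB.
  rewrite ABE; apply: TU => // c cF.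
  have : c \in A `|` B by rewrite ABE inE cF.
  by rewrite inE => /orP[/A1|/B1].
(* The second set lies in [T b.+1], so it must start after [b]. Thus [b] goes to the first set,
   which is obtained from [A] by shifting [x] down to [b], since below [b] the union has only
   elements of [A]. *)
exists (b |` below A b), (above (A `|` B) b.+1); split.
- exact: diag_left dA xA bx b0.
- exists b.+1; split=> // [c|]; first by rewrite in_above => /andP[].
  apply: (regular_sub (Treg _) TAB) => //.
  by apply/fsubsetP => c; rewrite in_above => /andP[].
- move=> c d; rewrite in_fset1U in_below in_above => cb /andP[_].
  by apply: leq_ltn_trans; case/orP: cb => [/eqP->//|/andP[_ /ltnW]].
apply/fsetP => c; rewrite !(in_above, in_fset1U, in_below, inE).
case: (ltngtP c b) => [cb|bc|->]; rewrite ?andbF ?andbT ?orbF ?bB ?orbT //=.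
by case: (boolP (c \in B)) => [/lebB|]; rewrite ?orbF // leqNgt cb.
Qed.

Lemma diag_regular : regular diag.
Proof.
split.
- exact: diag0.
- exact: diag1.
- exact: diag_sub.
- exact: diag_left.
- by apply: two_sym => [|A B a b]; [exact: diag0 | exact: diag_two_le].
Qed.

End LimitFamily.

(** * From coverings to indexed unions and back *)

Lemma seq_cover_bigU S n (E : 'I_n -> {fset nat}) :
  (forall i, S (E i)) -> (forall i j : 'I_n, (i < j)%N -> fset_lt (E i) (E j)) ->
  seq_cover S n (\big[fsetU/fset0]_(i < n) E i).
Proof.
elim: n E => [|n IHn] E SE ltE /=; first by rewrite big_ord0.
exists (E ord0), (\big[fsetU/fset0]_(i < n) E (lift ord0 i)); rewrite big_ord_recl.
split=> //; first by apply: IHn => // i j ij; exact: ltE.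
move=> a b aE /bigfcupP[i _ bE]; exact: ltE aE bE.
Qed.

Lemma cover_bigU S n (E : 'I_n -> {fset nat}) :
  (forall i, S (E i)) -> cover S n (\big[fsetU/fset0]_(i < n) E i).
Proof.
elim: n E => [|n IHn] E SE /=; first by rewrite big_ord0.
exists (E ord0), (\big[fsetU/fset0]_(i < n) E (lift ord0 i)); rewrite big_ord_recl.
by split=> //; exact: IHn.
Qed.

(** Empty pieces are discarded, as the definition of [schreier] requires; their number can only
    drop, so a bound [n] on the minimum remains valid for [m.+1]. *)
Lemma seq_cover_nonempty S n A : seq_cover S n A -> A != fset0 ->
  exists m (E : 'I_m.+1 -> {fset nat}),
    [/\ (m < n)%N, forall i, S (E i) /\ E i != fset0,
        forall i j : 'I_m.+1, (i < j)%N -> fset_lt (E i) (E j) &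
        A = \big[fsetU/fset0]_(i < m.+1) E i].
Proof.
elim: n A => /= [A ->|n IHn A [F [G [SF cG FG ->]]]]; first by rewrite eqxx.
have [->|F0] := eqVneq F fset0.
  rewrite fset0U => /(IHn _ cG)[m [E [mn SE ltE GE]]].
  by exists m, E; split=> //; exact: ltnW.
have [->|G0 _] := eqVneq G fset0.
  rewrite fsetU0 => _; exists 0%N, (fun=> F); split=> //.
    by move=> i j; rewrite !ord1.
  by rewrite big_ord1.
have [m [E [mn SE ltE GE]]] := IHn _ cG G0.
exists m.+1, (fun i => if unlift ord0 i is Some j then E j else F); split=> //.
- by move=> i; case: unliftP => [j|] _.
- move=> i j; case: unliftP => [i'|] ->; case: unliftP => [j'|] -> //=.
    exact: ltE.
  move=> _ a b aF bE; apply: FG => //; rewrite GE.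
  by apply/bigfcupP; exists j'; rewrite ?mem_index_enum.
- rewrite big_ord_recl unlift_none GE; congr (_ `|` _).
  by apply: eq_bigr => i _; rewrite liftK.
Qed.

(** * Transfinite induction on countable ordinals *)

Lemma omega1_ind (P : omega1 -> Prop) : P \bot ->
  (forall xi, P xi -> P (osucc xi)) ->
  (forall xi, is_limit xi -> (forall eta, eta < xi -> P eta) -> P xi) ->
  forall xi, P xi.
Proof.
move=> P0 PS PL xi; apply: contrapT => nP.
have [|z nPz zmin] := @omega1_min [set x | ~ P x]%classic; first by exists xi.
have Plt eta : eta < z -> P eta.
  by move=> ez; apply: contrapT => /zmin; rewrite leNgt ez.
apply: nPz; have [->//|z0] := eqVneq z \bot.
have [[y zy]|zS] := pselect (is_succ z); last exact: PL.
by rewrite zy; apply/PS/Plt; rewrite zy osucc_gt.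
Qed.

Lemma osucc_neq0 xi : osucc xi <> \bot.
Proof. by move=> e; have := osucc_gt xi; rewrite e ltx0. Qed.

Lemma osucc_inj : injective osucc.
Proof.
move=> x y e; case: (ltgtP x y) => // /osucc_le.
- by rewrite e leNgt osucc_gt.
- by rewrite -e leNgt osucc_gt.
Qed.

(** * The Schreier and modified Schreier families *)

Section Families.
Variable alpha : omega1 -> nat -> omega1.

Lemma schreier_botP E :
  schreier alpha \bot E <-> E = fset0 \/ exists2 k, (0 < k)%N & E = [fset k].
Proof.
split=> [|[->|[k k0 ->]]]; [|exact: schreier_zero0|exact: schreier_zero1].
move z0: (\bot : omega1) => z h.
case: h z0 => [k k0 _|_|g e|g n F _ _ _ _ e|xi n F [xi0 _] _ _ _ e].
- by right; exists k.
- by left.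
- by case: (osucc_neq0 (esym e)).
- by case: (osucc_neq0 (esym e)).
- by rewrite -e eqxx in xi0.
Qed.

(** Inversion works because zero, successors and limits exclude one another and [osucc] is
    injective. *)
Lemma schreier_succP xi E :
  schreier alpha (osucc xi) E <-> next (schreier alpha xi) E.
Proof.
split=> [|[n nE cE]].
  move zE: (osucc xi) => z h; case: h zE.
  - by move=> k _ /osucc_neq0.
  - by move/osucc_neq0.
  - by move=> g _; exact: next0.
  - move=> g n F SF F0 nF ltF /osucc_inj ->; exists n.+1; last exact: seq_cover_bigU.
    (* The bound is given for the first piece only; this piece is nonempty and precedes the others,
       so they inherit it. *)
    move=> a /bigfcupP[i _]; case: (posnP i) => [i0|i0].
      by rewrite (_ : i = ord0) => [/nF//|]; exact/val_inj.
    case/fset0Pn: (F0 ord0) => c cF aF; apply: leq_trans (nF _ cF) _.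
    exact/ltnW/(ltF ord0 i i0 _ _ cF aF).
  - by move=> eta n F [_ nz] _ _ _ e; case: nz; exists xi.
have [->|E0] := eqVneq E fset0; first exact: schreier_succ0.
have [m [F [mn SF ltF EE]]] := seq_cover_nonempty cE E0.
rewrite EE; apply: schreier_succ => // [i|i|a aF].
- by case: (SF i).
- by case: (SF i).
apply: leq_trans mn (nE _ _); rewrite EE; apply/bigfcupP.
by exists ord0; rewrite ?mem_index_enum.
Qed.

Lemma schreier_limitP xi E : is_limit xi ->
  schreier alpha xi E <-> diag (fun n => schreier alpha (alpha xi n)) E.
Proof.
move=> lxi; split=> [|[n [n0 nE SE]]]; last exact: schreier_limit SE.
case: (lxi) => xi0 xiS h; case: h xi0 xiS => [k _||g|g n F _ _ _ _|z n F _ n0 nF SF].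
- by rewrite eqxx.
- by rewrite eqxx.
- by move=> _ []; exists g.
- by move=> _ []; exists g.
- by exists n.
Qed.

Lemma mod_schreier_botP E : mod_schreier alpha \bot E <-> schreier alpha \bot E.
Proof.
split; last exact: mod_schreier_zero.
move z0: (\bot : omega1) => z h; case: h z0 => //.
- by move=> g n F _ _ _ e; case: (osucc_neq0 (esym e)).
- by move=> xi n F [xi0 _] _ _ _ e; rewrite -e eqxx in xi0.
Qed.

Lemma mod_schreier_succP xi E : mod_schreier alpha (osucc xi) E <->
  exists n (F : 'I_n.+1 -> {fset nat}),
    [/\ forall i, mod_schreier alpha xi (F i),
        forall i j : 'I_n.+1, i != j -> [disjoint F i & F j],
        forall i, le_fset n.+1 (F i) & E = \big[fsetU/fset0]_(i < n.+1) F i].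
Proof.
split=> [|[n [F [SF dF nF ->]]]]; last exact: mod_schreier_succ.
move zE: (osucc xi) => z h; case: h zE.
- by move=> F _ /osucc_neq0.
- by move=> g n F SF dF nF /osucc_inj ->; exists n, F.
- by move=> eta n F [_ nz] _ _ _ e; case: nz; exists xi.
Qed.

Lemma mod_schreier_limitP xi E : is_limit xi ->
  mod_schreier alpha xi E <-> diag (fun n => mod_schreier alpha (alpha xi n)) E.
Proof.
move=> lxi; split=> [|[n [n0 nE SE]]]; last exact: mod_schreier_limit SE.
case: (lxi) => xi0 xiS h; case: h xi0 xiS => [F _|g n F _ _ _|z n F _ n0 nF SF].
- by rewrite eqxx.
- by move=> _ []; exists g.
- by exists n.
Qed.

Hypothesis alphaP : schreier_sequences alpha.

Lemma schreier_bot_regular : regular (schreier alpha \bot).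
Proof.
split.
- exact: schreier_zero0.
- move=> y; split=> [/schreier_botP[|[k k0]] /fsetP e|]; last exact: schreier_zero1.
    by have := e y; rewrite !inE eqxx.
  by have := e y; rewrite !inE eqxx => /esym/eqP->.
- move=> A B /schreier_botP[->|[k k0 ->]].
    by rewrite fsubset0 => /eqP->; exact: schreier_zero0.
  rewrite fsubset1 => /orP[]/eqP->; first exact: schreier_zero1.
  exact: schreier_zero0.
- move=> A x y /schreier_botP[->|[k k0 ->]]; first by rewrite inE.
  rewrite inE => /eqP-> yk y0; rewrite (_ : below _ _ = fset0).
    by rewrite fsetU0; exact: schreier_zero1.
  apply/fsetP => c; rewrite in_below !inE.
  by case: eqP => // ->; rewrite ltnNge yk.
- apply: two_sym => [|A B a b aA _ _ ab bB SA SB]; first exact: schreier_zero0.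
  case/schreier_botP: (SA) aA => [->|[k k0 AE]]; first by rewrite inE.
  case/schreier_botP: (SB) bB => [->|[l l0 BE]]; first by rewrite inE.
  rewrite AE BE !inE => /eqP bl /eqP ak; rewrite -bl -ak in AE BE *.
  move: ab; rewrite leq_eqVlt => /orP[/eqP <-|ab].
    exists A, fset0; rewrite AE fsetUid fsetU0; split=> //.
    + by rewrite -AE.
    + exact: schreier_zero0.
  exists A, B; split; rewrite ?AE ?BE //; try by rewrite -?AE -?BE.
  by move=> c d; rewrite !inE => /eqP-> /eqP->.
Qed.

(** Minimum 1 allows only one piece, and a piece has at most one element. *)
Lemma schreier_one A : schreier alpha (osucc \bot) A -> 1%N \in A ->
  A = [fset 1%N].
Proof.
case/schreier_succP => n nA cA A1; move: (nA _ A1) cA.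
case: n {nA} => [|[|//]] _ /= => [e|[F [G [SF -> _ e]]]].
  by rewrite e inE in A1.
rewrite fsetU0 in e; rewrite -e in SF.
case/schreier_botP: SF A1 => [->|[k _ ->]]; rewrite inE //.
by move/eqP <-.
Qed.

Lemma schreier_regular xi : regular (schreier alpha xi).
Proof.
have eq_regular S T : (forall A, S A <-> T A) -> regular T -> regular S.
  by move=> ST; have -> : S = T by apply/funext => A; exact/propext.
elim/omega1_ind: xi => [|xi IH|xi lxi IH].
- exact: schreier_bot_regular.
- by apply: eq_regular (schreier_succP xi) _; exact: next_regular.
- apply: eq_regular (fun E => schreier_limitP E lxi) _; apply: diag_regular.
  + by move=> n n0; apply: IH; exact: alpha_lt.
  + by rewrite alpha_one //; exact: schreier_one.
  + by move=> n A B n0 SA SB A1 AB; exact: alpha_union.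
Qed.

Lemma schreier_mod_schreier xi E : schreier alpha xi E <-> mod_schreier alpha xi E.
Proof.
elim/omega1_ind: xi E => [|xi IH|xi lxi IH] E.
- exact: iff_sym (mod_schreier_botP E).
- have Sreg := schreier_regular xi.
  split=> [|/mod_schreier_succP[n [F [SF _ nF ->]]]].
    case/schreier_succP => n nE cE; apply/mod_schreier_succP.
    have [->|E0] := eqVneq E fset0.
      exists 0%N, (fun=> fset0); split=> //; last by rewrite big_ord1.
      + by move=> _; apply/IH; exact: regular0.
      + by move=> i j; rewrite !ord1.
    have [m [F [mn SF ltF EE]]] := seq_cover_nonempty cE E0.
    exists m, F; split=> // [i|i j ij|i a aF].
    + by apply/IH; case: (SF i).
    + have d (k l : 'I_m.+1) : (k < l)%N -> [disjoint F k & F l].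
        move=> kl; apply/fdisjointP => a aF; apply/negP => aF'.
        by have := ltF _ _ kl _ _ aF aF'; rewrite ltnn.
      case: (ltngtP i j) => [/d//|/d|/val_inj e]; first by rewrite fdisjoint_sym.
      by rewrite e eqxx in ij.
    + apply: leq_trans mn (nE _ _); rewrite EE.
      by apply/bigfcupP; exists i; rewrite ?mem_index_enum.
  (* The [n.+1] modified pieces cover the union and all respect the bound [n.+1]; by induction they
     lie in the Schreier family, where they can be made successive. *)
  apply/schreier_succP; exists n.+1; first by move=> a /bigfcupP[i _ /nF].
  by apply: cover_seq_cover => //; apply: cover_bigU => i; apply/IH.
- split=> [/(schreier_limitP _ lxi)|/(mod_schreier_limitP _ lxi)] [n [n0 nE SE]].
    by apply: (mod_schreier_limit lxi n0 nE); apply/IH => //; exact: alpha_lt.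
  by apply: (schreier_limit lxi n0 nE); apply/IH => //; exact: alpha_lt.
Qed.

End Families.

Theorem corollary3p6 (alpha : omega1 -> nat -> omega1)
  (alphaP : schreier_sequences alpha) (xi : omega1) (xi_ge1 : osucc \bot <= xi) :
  [set E | schreier alpha xi E]%classic =
  [set E | mod_schreier alpha xi E]%classic.
Proof. by apply/funext => E; exact/propext/schreier_mod_schreier. Qed.
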